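(* Let $X$ be a Banach space. For every Banach space $Y$ and every bounded linear operator $T\colon X\to Y$, $$\tfrac12\operatorname{uc}(T)\leq\operatorname{fix}_{c_0}(T)\leq\operatorname{uc}(T).$$
   Context: Scalars may be real or complex. For a bounded sequence $(y_n)$ in a Banach space, $\operatorname{ca}((y_n))=\inf_{n\in\mathbb N}\sup\{\|y_k-y_l\|: k,l\geq n\}$. For a bounded linear operator $T\colon X\to Y$, $$\operatorname{uc}(T)=\sup\Big\{\operatorname{ca}\Big(\big(\textstyle\sum_{i=1}^n Tx_i\big)_n\Big):\ (x_n)\subset X,\ \sup_{x^*\in B_{X^*}}\sum_{n=1}^\infty|x^*(x_n)|\leq 1\Big\}.$$ Further, $\operatorname{fix}_{c_0}(T)$ is the supremum of $(\|U\|\|V\|)^{-1}$ over all closed subspaces $X_0\subset X$ such that $T\restriction_{X_0}$ is an isomorphism onto $T(X_0)$ and $(T\restriction_{X_0})^{-1}=U\circ V$ for some surjective isomorphisms $U\colon c_0\to X_0$ and $V\colon T(X_0)\to c_0$; if there are no such $X_0,U,V$, then $\operatorname{fix}_{c_0}(T)=0$. *)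

(* Defs.v *)
From HB Require Import structures.
From mathcomp Require Import all_boot all_order all_algebra.
From mathcomp Require Import complex.
From mathcomp Require Import all_classical all_reals ereal topology normedtype sequences.
Import Order.TTheory GRing.Theory Num.Theory numFieldNormedType.Exports.

Set Implicit Arguments.
Unset Strict Implicit.
Unset Printing Implicit Defensive.

Local Open Scope classical_set_scope.
Local Open Scope ring_scope.

(* Scalars K (real: K = R, complex: K = R[i]); norms of vectors live in K
   (they are real elements of K); [toR : K -> R] converts them to R so that
   suprema/infima can be taken in the extended reals \bar R.
   In the theorem: toR = id for K = R and toR = complex.Re for K = R[i]. *)
Section Defs.
Variables (R : realType) (K : numFieldType) (toR : K -> R).

Definition is_linear (X Y : normedModType K) (f : X -> Y) : Prop :=
  forall (a : K) (x y : X), f (a *: x + y) = a *: f x + f y.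

Definition is_bounded (X Y : normedModType K) (f : X -> Y) : Prop :=
  exists M : K, forall x : X, `|f x| <= M * `|x|.

Definition dual_ball (X : normedModType K) : set (X -> K) :=
  [set f | (forall (a : K) (x y : X), f (a *: x + y) = a * f x + f y) /\
           (forall x : X, `|f x| <= `|x|)].

Definition weakly_summable_le1 (X : normedModType K) (x : nat -> X) : Prop :=
  forall f, @dual_ball X f ->
  forall N : nat, \sum_(n < N) `|f (x n)| <= 1.

Definition ca (Y : normedModType K) (y : nat -> Y) : \bar R :=
  ereal_inf [set ereal_sup [set r | exists k l : nat,
                               [/\ (n <= k)%N, (n <= l)%N & r = (toR `|y k - y l|)%:E]]
            | n in [set: nat]].

Definition uc (X Y : normedModType K) (T : X -> Y) : \bar R :=
  ereal_sup [set ca (fun n => \sum_(i < n.+1) T (x i))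
            | x in [set x : nat -> X | weakly_summable_le1 x]].

Definition c0 : set (nat -> K) := [set a | a @ \oo --> (0 : K)].

Definition supnorm (a : nat -> K) : \bar R :=
  ereal_sup [set (toR `|a n|)%:E | n in [set: nat]].

Definition closed_subspace (X : normedModType K) (X0 : set X) : Prop :=
  X0 0 /\ (forall (a : K) (x y : X), X0 x -> X0 y -> X0 (a *: x + y)) /\
  closed X0.

Definition iso_on (X Y : normedModType K) (T : X -> Y) (X0 : set X) : Prop :=
  set_inj X0 T /\ exists c : K, 0 < c /\ forall x, X0 x -> c * `|x| <= `|T x|.

Definition c0_iso_onto (X : normedModType K) (U : (nat -> K) -> X) (X0 : set X)
  : Prop :=
  (forall a, c0 a -> X0 (U a)) /\
  (forall (k : K) a b, c0 a -> c0 b ->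
     U (fun n => k * a n + b n) = k *: U a + U b) /\
  set_inj c0 U /\ (forall x, X0 x -> exists2 a, c0 a & U a = x) /\
  (exists M : R, forall a, c0 a -> (toR `|U a|)%:E <= M%:E * supnorm a)%E /\
  (exists c : R, 0 < c /\ forall a, c0 a -> (c%:E * supnorm a <= (toR `|U a|)%:E)%E).

Definition iso_onto_c0 (Y : normedModType K) (V : Y -> nat -> K) (Y0 : set Y)
  : Prop :=
  (forall y, Y0 y -> c0 (V y)) /\
  (forall (k : K) y z, Y0 y -> Y0 z ->
     V (k *: y + z) = (fun n => k * V y n + V z n)) /\
  set_inj Y0 V /\ (forall a, c0 a -> exists2 y, Y0 y & V y = a) /\
  (exists M : R, forall y, Y0 y -> (supnorm (V y) <= (M * toR `|y|)%:E)%E) /\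
  (exists c : R, 0 < c /\ forall y, Y0 y -> ((c * toR `|y|)%:E <= supnorm (V y))%E).

Definition opnorm_U (X : normedModType K) (U : (nat -> K) -> X) : \bar R :=
  ereal_sup [set (toR `|U a|)%:E | a in [set a | c0 a /\ (supnorm a <= 1)%E]].

Definition opnorm_V (Y : normedModType K) (V : Y -> nat -> K) (Y0 : set Y)
  : \bar R :=
  ereal_sup [set supnorm (V y) | y in [set y | Y0 y /\ `|y| <= 1]].

Definition fix_c0_vals (X Y : normedModType K) (T : X -> Y) : set (\bar R) :=
  [set r | exists (X0 : set X) (U : (nat -> K) -> X) (V : Y -> nat -> K),
     closed_subspace X0 /\ iso_on T X0 /\
     c0_iso_onto U X0 /\ iso_onto_c0 V (T @` X0) /\
     (forall x, X0 x -> U (V (T x)) = x) /\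
     r = ((fine (opnorm_U U) * fine (opnorm_V V (T @` X0)))^-1)%:E].

Definition fix_c0 (X Y : normedModType K) (T : X -> Y) : \bar R :=
  if fix_c0_vals T == set0 then 0%E else ereal_sup (fix_c0_vals T).

End Defs.

(* Main.v *)
Require Import Defs.
From HB Require Import structures.
From mathcomp Require Import all_boot all_order all_algebra.
From mathcomp Require Import complex.
From mathcomp Require Import all_classical all_reals ereal topology normedtype sequences.
From mathcomp Require Import ring lra.
Import Order.TTheory GRing.Theory Num.Theory numFieldNormedType.Exports.
Local Open Scope classical_set_scope.
Local Open Scope ring_scope.

Set Implicit Arguments.
Unset Strict Implicit.
Unset Printing Implicit Defensive.

(* If U and V witness a value of fix_c0, then the images under U / ||U|| of the
   unit vectors of c0 form a weakly unconditionally Cauchy series of norm at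
   most 1 whose terms are mapped by T to vectors of norm at least
   1 / (||U|| ||V||); hence fix_c0 <= uc.

   Conversely, let d < ca (sum T x_i). Consecutive blocks y_j of the series
   satisfy ||T y_j|| > d. By Hahn-Banach, choose functionals g_n of norm at most
   1 with |g_n (T y_n)| = ||T y_n||. The rows of the matrix |g_n (T y_m)| have
   sums at most ||T||, so Rosenthal's lemma yields a subsequence along which the
   off-diagonal row sums are at most e. On this subsequence
   (d - e) sup |a_n| <= ||sum a_n T y_n|| and ||sum a_n y_n|| <= sup |a_n|,
   so T fixes a copy of c0 with constant at least d - e. The argument gives
   uc <= fix_c0, without the factor 1/2. *)

(** * Rosenthal's lemma *)

(* Split the indices into infinitely many infinite classes. Either some class
   works, or each class p contains an index tau p whose row has sum more than e
   within the class; the tau p then satisfy the hypothesis with k - 1. *)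
Lemma rosenthal (R : realType) (e : R) (k : nat) (a : nat -> nat -> R) :
  0 <= e ->
  (forall n (s : seq nat), uniq s -> n \notin s -> \sum_(m <- s) a n m <= e *+ k) ->
  exists s : nat -> nat, injective s /\
    forall n (t : seq nat), uniq t -> n \notin t -> \sum_(m <- t) a (s n) (s m) <= e.
Proof.
move=> e0; elim: k a => [|k IH] a ha.
  exists id; split=> // n t ut nt.
  by apply: (le_trans (ha n t ut nt)); rewrite mulr0n.
(* Class [p] is the range of [code p]; the pairing makes the classes infinite and disjoint. *)
pose code (p j : nat) : nat := pickle (p, j).
have codeI p j p' j' : code p j = code p' j' -> p = p' /\ j = j'.
  by move=> /(pcan_inj pickleK) [-> ->].
have [[p hp]|H] := pselect (exists p, forall n (t : seq nat), uniq t -> n \notin t ->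
    \sum_(m <- t) a (code p n) (code p m) <= e).
  by exists (code p); split=> // i j /codeI[].
have {}H p : exists js : nat * seq nat, [/\ uniq js.2, js.1 \notin js.2 &
    e < \sum_(m <- js.2) a (code p js.1) (code p m)].
  apply/not_existsP => Hp; apply: H; exists p => n t ut nt.
  by rewrite leNgt; apply/negP => lt; apply: (Hp (n, t)); split.
have [f Hf] := choice H.
pose tau p := code p (f p).1.
have tauI : injective tau by move=> p q /codeI[].
have [|s [sI Hs]] := IH (fun p q => a (tau p) (tau q)).
  move=> p t ut pt; have [uf nf lf] := Hf p.
  rewrite -(lerD2l e) -mulrS.
  (* Row [tau p] is tested on [tau t] together with the witness set inside class [p]. These are
     disjoint because [p] is not in [t]; the witness set alone contributes more than [e], which
     leaves at most [e *+ k] for [tau t]. *)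
  apply: le_trans (ha (tau p) (map tau t ++ map (code p) (f p).2) _ _).
  - rewrite big_cat/= !big_map [leLHS]addrC lerD2l; exact: ltW.
  - rewrite cat_uniq !map_inj_uniq// => [|i j /codeI[]//].
    rewrite ut uf andbT /=; apply/hasPn => _ /mapP[j jf ->].
    apply/mapP => -[q qt /codeI[pq _]].
    by move: pt; rewrite pq qt.
  - rewrite mem_cat mem_map// negb_or pt /=.
    apply/mapP => -[j jf /codeI[_ jE]].
    by move: nf; rewrite jE jf.
by exists (tau \o s); split; [exact: inj_comp|exact: Hs].
Qed.

(** * The Hahn-Banach theorem *)

Section hahn_banach.
Variables (R : realType) (K : numFieldType) (ofR : {rmorphism R -> K}).
Variable X : lmodType K.
Implicit Types (p q : X -> R) (x y : X).

(** Homogeneity involves only real scalars, through [ofR], so that one extension argument serves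
    real and complex spaces. *)
Definition sublinear p :=
  (forall x y, p (x + y) <= p x + p y) /\
  (forall (r : R) x, 0 <= r -> p (ofR r *: x) = r * p x).

Lemma sublinear0 p : sublinear p -> p 0 = 0.
Proof. by move=> [_ ph]; rewrite -(scaler0 _ (ofR 0)) ph// mul0r. Qed.

Lemma sublinearN p x : sublinear p -> - p (- x) <= p x.
Proof.
by move=> hp; rewrite -subr_ge0 opprK -(sublinear0 hp) -(subrr x) hp.1.
Qed.

(** One inequality suffices for homogeneity: applied to [r^-1] it yields the reverse one. *)
Lemma sublinearP p : p 0 = 0 -> (forall x y, p (x + y) <= p x + p y) ->
  (forall (r : R) x, 0 < r -> p (ofR r *: x) <= r * p x) -> sublinear p.
Proof.
move=> p0 pD ph; split=> // r x; rewrite le_eqVlt => /predU1P[<-|r0].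
  by rewrite rmorph0 scale0r p0 mul0r.
have rE y : y = ofR r^-1 *: (ofR r *: y).
  by rewrite scalerA -rmorphM mulVf ?gt_eqF// rmorph1 scale1r.
apply/eqP; rewrite eq_le ph//= -ler_pdivlMl// [x in leLHS]rE.
by apply: ph; rewrite invr_gt0.
Qed.

(* The value of [tilt p y] at [- y] is at most [- p y]. So a minimal sublinear
   functional, being equal to all of its tilts, is odd, hence linear; and a
   linear functional below [tilt p y] agrees with [p] at [y]. *)
Definition tilt p y x : R :=
  inf [set p (x + ofR t *: y) - t * p y | t in [set t | 0 <= t]].

Lemma tilt_le p y x t : sublinear p -> 0 <= t ->
  tilt p y x <= p (x + ofR t *: y) - t * p y.
Proof.
move=> hp t0; apply: inf_lbound; last by exists t.
(* The infimum is finite since [s * p y = p (ofR s *: y) <= p (x + ofR s *: y) + p (- x)]. *)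
exists (- p (- x)) => _ [s s0 <-]; rewrite lerBrDr addrC lerBlDr -hp.2//.
by rewrite (le_trans _ (hp.1 _ _))// addrC addKr.
Qed.

Lemma le_tilt p y x c :
  (forall t : R, 0 <= t -> c <= p (x + ofR t *: y) - t * p y) -> c <= tilt p y x.
Proof.
move=> H; apply: lb_le_inf => [|_ [t t0 <-]]; last exact: H.
by exists (p (x + ofR 0 *: y) - 0 * p y), 0 => /=.
Qed.

Lemma tilt_le_self p y x : sublinear p -> tilt p y x <= p x.
Proof.
move=> hp; have := tilt_le y x hp (lexx 0).
by rewrite rmorph0 scale0r addr0 mul0r subr0.
Qed.

Lemma sublinear_tilt p y : sublinear p -> sublinear (tilt p y).
Proof.
move=> hp; apply: sublinearP.
- apply/eqP; rewrite eq_le; apply/andP; split.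
    by rewrite -(sublinear0 hp) tilt_le_self.
  by apply: le_tilt => t t0; rewrite add0r hp.2// subrr.
(* Parameters [s] for [x] and [t] for [x'] combine to [t + s] for the sum. *)
- move=> x x'; rewrite -lerBlDl; apply: le_tilt => t t0.
  rewrite lerBlDl -lerBlDr; apply: le_tilt => s s0; rewrite lerBlDr.
  apply: (le_trans (tilt_le y (x + x') hp (addr_ge0 t0 s0))).
  have -> : x + x' + ofR (t + s) *: y = (x' + ofR t *: y) + (x + ofR s *: y).
    by rewrite rmorphD scalerDl [x + x']addrC addrACA.
  have := hp.1 (x' + ofR t *: y) (x + ofR s *: y); lra.
- move=> r x r0; rewrite -ler_pdivrMl//; apply: le_tilt => t t0.
  rewrite ler_pdivrMl//.
  apply: (le_trans (tilt_le y (ofR r *: x) hp (mulr_ge0 (ltW r0) t0))).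
  by rewrite rmorphM -scalerA -scalerDr hp.2 ?(ltW r0)// mulrBr mulrA.
Qed.

(** Zorn's lemma for the reversed pointwise order. A chain is bounded by its pointwise infimum,
    finite because every member is at least [- p (- x)] at [x]; for subadditivity, both terms are
    compared with the smaller of two members of the chain. *)
Lemma minimal_sublinear p : sublinear p ->
  exists q, [/\ sublinear q, (forall x, q x <= p x) &
    forall q', sublinear q' -> (forall x, q' x <= q x) -> q' = q].
Proof.
move=> hp.
pose T := {q : X -> R | sublinear q /\ forall x, q x <= p x}.
pose le (s t : T) := `[< forall x, sval t x <= sval s x >].
pose t0 : T := exist _ p (conj hp (fun x => lexx (p x))).
have [| | | |[q [hq qp]] qmin] := @Zorn T le.
- by move=> t; apply/asboolP.
- move=> r s t /asboolP rs /asboolP st; apply/asboolP => x.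
  exact: le_trans (st x) (rs x).
- move=> [s hs] [t ht] /asboolP st /asboolP ts; apply: eq_exist.
  by apply/funext => x; apply/eqP; rewrite eq_le st ts.
- move=> A totA; have [->|/set0P[a0 Aa0]] := eqVneq A set0.
    by exists t0 => s.
  pose B x := [set sval a x | a in A].
  have lbB x a : A a -> inf (B x) <= sval a x.
    move=> Aa; apply: inf_lbound; last by exists a.
    exists (- p (- x)) => _ [[s [hs sp]] As <-] /=.
    by apply: le_trans (sublinearN x hs); rewrite lerN2.
  have leB x c : (forall a, A a -> c <= sval a x) -> c <= inf (B x).
    move=> H; apply: lb_le_inf => [|_ [a Aa <-]]; last exact: H.
    by exists (sval a0 x), a0.
  have hm : sublinear (fun x => inf (B x)) /\ forall x, inf (B x) <= p x.
    split; last by move=> x; apply: le_trans (lbB x _ Aa0) ((svalP a0).2 x).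
    apply: sublinearP.
    - apply/eqP; rewrite eq_le; apply/andP; split.
        by rewrite (le_trans (lbB _ _ Aa0))// (sublinear0 (svalP a0).1).
      by apply: (leB) => a _; rewrite (sublinear0 (svalP a).1).
    - move=> x y; rewrite -lerBlDl; apply: (leB) => b Ab.
      rewrite lerBlDl -lerBlDr; apply: (leB) => a Aa; rewrite lerBlDr.
      have [/asboolP ba|/asboolP ab] := totA _ _ Aa Ab.
      + apply: (le_trans (lbB _ _ Ab)); apply: (le_trans ((svalP b).1.1 x y)).
        by rewrite lerD2r.
      + apply: (le_trans (lbB _ _ Aa)); apply: (le_trans ((svalP a).1.1 x y)).
        by rewrite lerD2l.
    - move=> r x r0; rewrite -ler_pdivrMl//; apply: (leB) => a Aa.
      rewrite ler_pdivrMl// -(svalP a).1.2 ?(ltW r0)//; exact: lbB.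
  by exists (exist _ (fun x => inf (B x)) hm) => a Aa; apply/asboolP => x; exact: lbB.
exists q; split=> // q' hq' q'q.
have hq'p : sublinear q' /\ forall x, q' x <= p x.
  by split=> // x; exact: le_trans (q'q x) (qp x).
by have /(congr1 sval) := qmin (exist _ q' hq'p) (asboolT q'q).
Qed.

Lemma hahn_banach p y : sublinear p ->
  exists f : X -> R, [/\ {morph f : x z / x + z},
    (forall (r : R) x, f (ofR r *: x) = r * f x), (forall x, f x <= p x) & f y = p y].
Proof.
move=> hp; have htilt := sublinear_tilt y hp.
have [f [hf ftilt fmin]] := minimal_sublinear htilt.
have fp x : f x <= p x by exact: le_trans (ftilt x) (tilt_le_self y x hp).
have fN x : f (- x) = - f x.
  apply/eqP; rewrite eq_le; apply/andP; split.
    (* By minimality [f] equals its tilt along [x]; the parameter 1 at [- x] then gives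
       [f (- x) <= f 0 - f x]. *)
    have E := fmin _ (sublinear_tilt x hf) (fun z => tilt_le_self x z hf).
    rewrite -[in leLHS]E; apply: (le_trans (tilt_le x (- x) hf ler01)).
    by rewrite rmorph1 scale1r addNr (sublinear0 hf) mul1r sub0r.
  by have := sublinearN (- x) hf; rewrite opprK.
exists f; split => //.
- move=> x z; apply/eqP; rewrite eq_le hf.1/= -[x + z]opprK fN opprD.
  by rewrite lerNr opprD -!fN; exact: hf.1.
- move=> r x; have [r0|r0] := leP 0 r; first exact: hf.2.
  rewrite -[r]opprK rmorphN scaleNr fN hf.2 ?mulNr// oppr_ge0.
  exact: ltW.
- apply/eqP; rewrite eq_le fp/= -[y in leRHS]opprK fN lerNr.
  apply: (le_trans (ftilt _)); apply: (le_trans (tilt_le y (- y) hp ler01)).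
  by rewrite rmorph1 scale1r addNr (sublinear0 hp) mul1r sub0r.
Qed.
End hahn_banach.

(** * Real-valued norms over a field with a real part *)

(* Common interface of (R, id) and (R[i], Re), with [ofR] the embedding of R. *)
Record real_part (R : realType) (K : numFieldType) (toR : K -> R)
    (ofR : {rmorphism R -> K}) : Prop := RealPart {
  ofRK : cancel ofR toR;
  toRK : forall x, 0 <= x -> ofR (toR x) = x;
  toRD : {morph toR : x y / x + y};
  toRZ : forall r x, toR (ofR r * x) = r * toR x;
  le_toR : {homo toR : x y / x <= y};
  ler_ofR : {mono ofR : r s / r <= s} }.

Section real_norm.
Variables (R : realType) (K : numFieldType) (toR : K -> R).
Variables (ofR : {rmorphism R -> K}) (hR : real_part toR ofR).

Definition realnorm (V : normedZmodType K) (x : V) : R := toR `|x|.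

Local Notation nrm := realnorm.

(** Convergence with real tolerances. [cvg_econv] identifies it with convergence of filters, whose
    tolerances lie in [K]. *)
Definition econv (V : normedZmodType K) (u : nat -> V) (l : V) :=
  forall e : R, 0 < e -> exists N, forall n, (N <= n)%N -> nrm (u n - l) <= e.

Definition ecauchy (V : normedZmodType K) (u : nat -> V) :=
  forall e : R, 0 < e ->
    exists N, forall m n, (N <= m)%N -> (N <= n)%N -> nrm (u m - u n) <= e.

Section zmod.
Variable V : normedZmodType K.
Implicit Types x y : V.

Lemma ofR_nrm x : ofR (nrm x) = `|x|.
Proof. by rewrite (toRK hR). Qed.

Lemma nrm0 : nrm (0 : V) = 0.
Proof. by rewrite /realnorm normr0 -(rmorph0 ofR) (ofRK hR). Qed.

Lemma nrm_ge0 x : 0 <= nrm x.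
Proof. by rewrite -nrm0; apply: (le_toR hR); rewrite normr0. Qed.

Lemma nrm0_eq0 x : nrm x = 0 -> x = 0.
Proof. by move=> h; apply/normr0_eq0; rewrite -ofR_nrm h rmorph0. Qed.

Lemma nrmN x : nrm (- x) = nrm x.
Proof. by rewrite /realnorm normrN. Qed.

Lemma nrmBC x y : nrm (x - y) = nrm (y - x).
Proof. by rewrite /realnorm distrC. Qed.

Lemma ler_nrmD x y : nrm (x + y) <= nrm x + nrm y.
Proof. by rewrite -(toRD hR); apply: (le_toR hR); exact: ler_normD. Qed.

Lemma ler_nrmB x y : nrm (x - y) <= nrm x + nrm y.
Proof. by rewrite -[nrm y]nrmN ler_nrmD. Qed.

Lemma ler_nrm_dist y x z : nrm (x - z) <= nrm (x - y) + nrm (y - z).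
Proof. by apply: le_trans (ler_nrmD _ _); rewrite subrKA. Qed.

Lemma ler_nrm_sum I (s : seq I) (P : pred I) (F : I -> V) :
  nrm (\sum_(i <- s | P i) F i) <= \sum_(i <- s | P i) nrm (F i).
Proof.
elim/big_rec2: _ => [|i a y _ h]; first by rewrite nrm0.
by apply: le_trans (ler_nrmD _ _) _; rewrite lerD2l.
Qed.

Lemma econvD (u v : nat -> V) l l' :
  econv u l -> econv v l' -> econv (fun n => u n + v n) (l + l').
Proof.
move=> hu hv e e0; have e2 : 0 < e / 2 by rewrite divr_gt0.
have [N hN] := hu _ e2; have [M hM] := hv _ e2.
exists (maxn N M) => n; rewrite geq_max => /andP[Nn Mn].
rewrite opprD addrACA (le_trans (ler_nrmD _ _))// [e]splitr.
by rewrite lerD ?hN ?hM.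
Qed.

Lemma econv_nrm_le (u : nat -> V) l (c : R) N : econv u l ->
  (forall n, (N <= n)%N -> nrm (u n) <= c) -> nrm l <= c.
Proof.
move=> hu hc; apply/ler_addgt0Pr => e e0.
have [M hM] := hu e e0; pose n := maxn N M.
rewrite -[l](subKr (u n)) (le_trans (ler_nrmB _ _))//.
by rewrite lerD ?hc ?hM// /n ?leq_maxl ?leq_maxr.
Qed.

Lemma econv_nrm_ge (u : nat -> V) l (c : R) N : econv u l ->
  (forall n, (N <= n)%N -> c <= nrm (u n)) -> c <= nrm l.
Proof.
move=> hu hc; apply/ler_addgt0Pr => e e0.
have [M hM] := hu e e0; pose n := maxn N M.
have Nn : (N <= n)%N by rewrite leq_maxl.
apply: le_trans (hc n Nn) _; rewrite -[u n](subrK l) addrC.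
by rewrite (le_trans (ler_nrmD _ _))// lerD2l hM// leq_maxr.
Qed.

Lemma econv_uniq (u : nat -> V) l l' : econv u l -> econv u l' -> l = l'.
Proof.
move=> hl hl'; apply/eqP; rewrite -subr_eq0; apply/eqP/nrm0_eq0/eqP.
rewrite eq_le nrm_ge0 andbT; apply/ler_addgt0Pr => e e0; rewrite add0r.
have [N hN] := hl (e / 2) (divr_gt0 e0 (ltr0Sn _ 1)).
have [M hM] := hl' (e / 2) (divr_gt0 e0 (ltr0Sn _ 1)).
rewrite (le_trans (ler_nrm_dist (u (maxn N M)) _ _))// [e]splitr.
by rewrite lerD ?hM ?leq_maxr// nrmBC hN// leq_maxl.
Qed.

End zmod.

Lemma ler_nrm (V W : normedZmodType K) (x : V) (w : W) :
  (nrm x <= nrm w) = (`|x| <= `|w|).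
Proof. by rewrite -!ofR_nrm (ler_ofR hR). Qed.

Lemma nrmM (a b : K) : nrm (a * b) = nrm a * nrm b.
Proof. by rewrite /realnorm normrM -(toRZ hR) ofR_nrm. Qed.

Lemma nrm1 : nrm (1 : K) = 1.
Proof. by rewrite /realnorm normr1 -(rmorph1 ofR) (ofRK hR). Qed.

Lemma nrm_norm_div (a : K) : a != 0 -> nrm (`|a| / a) = 1.
Proof.
by move=> a0; rewrite /realnorm normrM normfV normr_id mulfV ?normr_eq0// -nrm1 /realnorm normr1.
Qed.

Section nmod.
Variable V : normedModType K.

Lemma nrmZ (a : K) (x : V) : nrm (a *: x) = nrm a * nrm x.
Proof. by rewrite /realnorm normrZ -(toRZ hR) ofR_nrm. Qed.

Lemma ofR_ge0 r : 0 <= r -> 0 <= ofR r.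
Proof. by move=> r0; rewrite -(rmorph0 ofR) (ler_ofR hR). Qed.

Lemma ofR_gt0 r : 0 < r -> 0 < ofR r.
Proof. by move=> r0; rewrite -(rmorph0 ofR) (leW_mono (ler_ofR hR)). Qed.

Lemma nrm_ofR r : 0 <= r -> nrm (ofR r) = r.
Proof. by move=> r0; rewrite /realnorm ger0_norm ?ofR_ge0// (ofRK hR). Qed.

Lemma econvZ (a : K) (u : nat -> V) l :
  econv u l -> econv (fun n => a *: u n) (a *: l).
Proof.
move=> hu e e0; have d0 : 0 < nrm a + 1 by rewrite ltr_wpDl ?nrm_ge0.
have [N hN] := hu (e / (nrm a + 1)) (divr_gt0 e0 d0).
exists N => n Nn; rewrite -scalerBr nrmZ.
rewrite -[leRHS](divfK (lt0r_neq0 d0)) [leRHS]mulrC ler_pM ?nrm_ge0 ?hN//.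
by rewrite lerDl.
Qed.

Lemma sublinear_nrm : sublinear ofR (fun x : V => nrm x).
Proof.
split=> [x y|r x r0]; first exact: ler_nrmD.
by rewrite nrmZ nrm_ofR.
Qed.

Lemma cvg_econv (u : nat -> V) l : u @ \oo --> l <-> econv u l.
Proof.
split=> [/cvgrPdist_le h e e0|h].
  have [N _ hN] := h _ (ofR_gt0 e0); exists N => n Nn.
  by rewrite -(nrm_ofR (ltW e0)) ler_nrm distrC (gtr0_norm (ofR_gt0 e0)) hN.
apply/cvgrPdist_le => e e0.
(* A positive element of [K] is real, so it is recovered from [toR e]. *)
have te0 : 0 < toR e.
  have h0 : ofR (toR e) = e by rewrite (toRK hR)// ltW.
  by rewrite -(leW_mono (ler_ofR hR)) h0 rmorph0.
have [N hN] := h _ te0; exists N => // n /hN.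
by rewrite -(ler_ofR hR) ofR_nrm (toRK hR) ?(ltW e0)//= distrC.
Qed.

End nmod.

Lemma c0P (a : nat -> K) : c0 a <-> econv a 0.
Proof. exact: (@cvg_econv K^o). Qed.

Lemma ecauchy_cvg (V : completeNormedModType K) (u : nat -> V) :
  ecauchy u -> exists l, econv u l.
Proof.
move=> h; suff /cvg_ex[l /cvg_econv hl] : cvg (u @ \oo) by exists l.
apply: cauchy_cvg; apply: cauchy_exP => e e0.
(* Halving turns the bound [<=] into the strict one that defines an open ball. *)
have te0 : 0 < toR e / 2.
  have h0 : ofR (toR e) = e by rewrite (toRK hR)// ltW.
  by rewrite divr_gt0// -(leW_mono (ler_ofR hR)) h0 rmorph0.
have [N hN] := h _ te0; exists (u N), N => // n /= Nn.
rewrite -ball_normE /=; have := hN N n (leqnn N) Nn.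
rewrite -(ler_ofR hR) ofR_nrm rmorphM fmorphV rmorph_nat (toRK hR) ?(ltW e0)//.
by move=> /le_lt_trans; apply; rewrite gtr_pMr// invf_lt1 ?ltr1n.
Qed.

End real_norm.

(** * The space c0, and the upper bound *)

Section linear_maps.
Variables (K : numFieldType) (X Y : lmodType K) (f : X -> Y).
Hypothesis lin_f : forall (a : K) x y, f (a *: x + y) = a *: f x + f y.

Lemma lin0 : f 0 = 0.
Proof.
by have := lin_f (-1) 0 0; rewrite scaler0 addr0 scaleN1r addNr.
Qed.

Lemma linZ a x : f (a *: x) = a *: f x.
Proof. by have := lin_f a x 0; rewrite lin0 !addr0. Qed.

Lemma linD x y : f (x + y) = f x + f y.
Proof. by have := lin_f 1 x y; rewrite !scale1r. Qed.

Lemma linB x y : f (x - y) = f x - f y.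
Proof. by rewrite linD -scaleN1r linZ scaleN1r. Qed.

Lemma lin_sum I (s : seq I) (P : pred I) (F : I -> X) :
  f (\sum_(i <- s | P i) F i) = \sum_(i <- s | P i) f (F i).
Proof. by rewrite (big_morph f linD lin0). Qed.

End linear_maps.

Lemma ler_sum_uniq (R : numDomainType) (F : nat -> R) (t : seq nat) (N : nat) :
  (forall i, 0 <= F i) -> uniq t -> (forall i, i \in t -> (i < N)%N) ->
  \sum_(i <- t) F i <= \sum_(i < N) F i.
Proof.
move=> F0 ut tN.
have /(perm_big _) -> : perm_eq t [seq i <- iota 0 N | i \in t].
  apply: uniq_perm => //; first by rewrite filter_uniq ?iota_uniq.
  move=> i; rewrite mem_filter mem_iota add0n /=.
  by case: (boolP (i \in t)) => // /tN ->.
rewrite big_filter -(big_mkord xpredT F) /index_iota subn0 big_mkcond.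
by apply: ler_sum => i _; case: ifP.
Qed.

(** Operator norms enter [fix_c0] through [fine], which sends infinite values to 0. An upper bound
    for all elements and a real lower bound for one of them exclude this. *)
Lemma ereal_sup_fin (R : realType) (S : set (\bar R)) (M r : R) :
  (forall x, S x -> (x <= M%:E)%E) -> (exists2 x, S x & (r%:E <= x)%E) ->
  [/\ ereal_sup S = (fine (ereal_sup S))%:E, fine (ereal_sup S) <= M,
    r <= fine (ereal_sup S) & forall x, S x -> (x <= (fine (ereal_sup S))%:E)%E].
Proof.
move=> hM [x Sx rx]; have hS y : S y -> (y <= ereal_sup S)%E.
  exact: ereal_sup_ubound.
have : (ereal_sup S <= M%:E)%E by exact: ge_ereal_sup.
have := le_trans rx (hS _ Sx).
by case: (ereal_sup S) hS => [s| |] //= hS; rewrite !lee_fin.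
Qed.

Section c0_sequences.
Variables (R : realType) (K : numFieldType) (toR : K -> R).
Variables (ofR : {rmorphism R -> K}) (hR : real_part toR ofR).
Implicit Types a b : nat -> K.

Local Notation nrm := (@realnorm R K toR _).

Lemma supnorm_leP a (M : R) :
  (supnorm toR a <= M%:E)%E <-> forall n, nrm (a n) <= M.
Proof.
split=> [h n|h]; last by apply: ge_ereal_sup => _ [n _ <-]; rewrite lee_fin h.
by rewrite -lee_fin; apply: le_trans h; apply: ereal_sup_ubound; exists n.
Qed.

Definition snorm a : R := fine (supnorm toR a).

Lemma c0_supnorm a : c0 a -> supnorm toR a = (snorm a)%:E.
Proof.
move=> /(c0P hR)/(_ 1 ltr01)[N hN].
(* Terms before [N] are bounded by the sum of their norms, later ones by 1. *)
suff hM n : nrm (a n) <= \sum_(i < N) nrm (a i) + 1.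
  have [] := ereal_sup_fin (M := \sum_(i < N) nrm (a i) + 1)
    (r := nrm (a 0%N)) (S := [set (toR `|a n|)%:E | n in [set: nat]]) => //.
  - by move=> _ [n _ <-]; rewrite lee_fin hM.
  - by exists (nrm (a 0%N))%:E => //; exists 0%N.
have [Nn|nN] := leqP N n.
  have := hN n Nn; rewrite subr0 => /le_trans; apply.
  by rewrite lerDr sumr_ge0// => i _; exact: nrm_ge0 hR _ _.
rewrite (bigD1 (Ordinal nN))//= -addrA lerDl addr_ge0// sumr_ge0// => i _.
exact: nrm_ge0 hR _ _.
Qed.

Lemma nrm_le_snorm a n : c0 a -> nrm (a n) <= snorm a.
Proof. by move=> ha; move: n; apply/supnorm_leP; rewrite c0_supnorm. Qed.

Lemma snorm_le a M : c0 a -> (forall n, nrm (a n) <= M) -> snorm a <= M.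
Proof. by move=> ha /supnorm_leP; rewrite c0_supnorm// lee_fin. Qed.

Lemma snorm_ge0 a : c0 a -> 0 <= snorm a.
Proof. by move=> ha; apply: le_trans (nrm_le_snorm 0 ha); exact: (nrm_ge0 hR). Qed.

Lemma c0_finsupp a N : (forall n, (N <= n)%N -> a n = 0) -> c0 a.
Proof.
move=> h; apply/(c0P hR) => e e0; exists N => n /h ->.
by rewrite subrr (nrm0 hR) ltW.
Qed.

Lemma c0_lin k a b : c0 a -> c0 b -> c0 (fun n => k * a n + b n).
Proof.
move=> /(c0P hR) ha /(c0P hR) hb; apply/(c0P hR).
by have := econvD hR (econvZ hR (V := K^o) k ha) hb; rewrite scaler0 addr0.
Qed.

Definition unit_seq (n m : nat) : K := (m == n)%:R.

Lemma c0_unit_seq n : c0 (unit_seq n).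
Proof.
apply: (@c0_finsupp _ n.+1) => m nm.
by rewrite /unit_seq; case: eqP nm => // ->; rewrite ltnn.
Qed.

Lemma nrm_unit_seq n m : nrm (unit_seq n m) <= 1.
Proof. by rewrite /unit_seq; case: eqP; rewrite ?(nrm1 hR)// (nrm0 hR). Qed.

Section isomorphism.
Variables (X : normedModType K) (U : (nat -> K) -> X).
Hypothesis linU : forall (k : K) a b, c0 a -> c0 b ->
  U (fun n => k * a n + b n) = k *: U a + U b.

Lemma c0_zero : c0 (fun=> 0 : K).
Proof. by apply: (@c0_finsupp _ 0). Qed.

Lemma c0_map0 : U (fun=> 0) = 0.
Proof.
have := linU (-1) c0_zero c0_zero; rewrite scaleN1r addNr => <-.
by congr U; apply/funext => n; rewrite mulr0 addr0.
Qed.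

Lemma c0_mapZ k a : c0 a -> U (fun n => k * a n) = k *: U a.
Proof.
move=> ha; have := linU k ha c0_zero; rewrite c0_map0 addr0 => <-.
by congr U; apply/funext => n; rewrite addr0.
Qed.

Lemma c0_map_sum (c : nat -> K) N :
  \sum_(i < N) c i *: U (unit_seq i) = U (fun n => if (n < N)%N then c n else 0).
Proof.
elim: N => [|N IH]; first by rewrite big_ord0 -c0_map0.
rewrite big_ord_recr/= IH addrC -linU; first last.
- by apply: (@c0_finsupp _ N) => n; rewrite ltnNge => ->.
- exact: c0_unit_seq.
congr U; apply/funext => n; rewrite /unit_seq.
have [->|nN] := eqVneq n N; first by rewrite ltnn ltnSn mulr1 addr0.
by rewrite mulr0 add0r ltnS [(n <= N)%N]leq_eqVlt (negbTE nN).
Qed.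

End isomorphism.


Lemma nrm_dual_ball (X : normedModType K) (f : X -> K) x :
  dual_ball f -> nrm (f x) <= nrm x.
Proof. by move=> [_ hf]; rewrite (ler_nrm hR). Qed.

(** Choose [c n] of norm at most 1 with [c n * f (x n) = |f (x n)|]. The sum of the first [N]
    absolute values is then [f] at the image under [U / u] of a finitely supported sequence in the
    unit ball of c0. *)
Lemma weakly_summable_unit_seq (X : normedModType K) (U : (nat -> K) -> X)
    (u : R) :
  (forall (k : K) a b, c0 a -> c0 b ->
     U (fun n => k * a n + b n) = k *: U a + U b) ->
  0 < u ->
  (forall a, c0 a -> (forall n, nrm (a n) <= 1) -> nrm (U a) <= u) ->
  weakly_summable_le1 (fun n => (ofR u)^-1 *: U (unit_seq n)).
Proof.
move=> linU u0 hu f hf N; pose x n := (ofR u)^-1 *: U (unit_seq n).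
have fsum := lin_sum (Y := K^o) hf.1.
have fZ := linZ (Y := K^o) hf.1.
pose c n := if f (x n) == 0 then 0 else `|f (x n)| / f (x n).
have hc n : nrm (c n) <= 1.
  rewrite /c; case: eqP => [_|/eqP fn]; first by rewrite (nrm0 hR).
  by rewrite (nrm_norm_div hR).
have cE n : c n * f (x n) = `|f (x n)|.
  rewrite /c; case: eqP => [->|/eqP fn]; first by rewrite mul0r normr0.
  by rewrite divfK.
pose a n := if (n < N)%N then c n else 0.
rewrite -[leLHS]ger0_norm ?sumr_ge0//.
have -> : \sum_(n < N) `|f (x n)| = f ((ofR u)^-1 *: U a).
  rewrite -c0_map_sum// scaler_sumr fsum; apply: eq_bigr => i _.
  by rewrite -cE scalerA [(ofR u)^-1 * c i]mulrC -scalerA [RHS]fZ.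
have ha : c0 a by apply: (@c0_finsupp _ N) => n; rewrite /a ltnNge => ->.
apply: le_trans (hf.2 _) _; rewrite -[leRHS]normr1 -(ler_nrm hR) (nrmZ hR).
rewrite (nrm1 hR) -fmorphV (nrm_ofR hR) ?invr_ge0 ?(ltW u0)//.
rewrite ler_pdivrMl// mulr1; apply: hu => // n; rewrite /a.
by case: ifP => // _; rewrite (nrm0 hR).
Qed.

Lemma fix_c0_vals_le_uc (X Y : normedModType K) (T : X -> Y) r :
  is_linear T -> fix_c0_vals toR T r -> (r <= uc toR T)%E.
Proof.
move=> linT [X0 [U [V [[_ [_ clX0]] [[injT _]]]]]].
move=> [[U0 [linU [injU [_ [[M hM] _]]]]] [[V0 [_ [_ [_ [[M' hM'] _]]]]] [UVT ->]]].
(* The identity [U (V (T x)) = x] on [X0] is reversed by injectivity of [U]. *)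
have VTU a : c0 a -> V (T (U a)) = a.
  move=> ha; have hUa := U0 _ ha; apply: injU; rewrite ?inE//; last exact: UVT.
  by apply: V0; exists (U a).
(* The norm of [U] is finite because [U] is bounded, and positive because [U] does not vanish on the
   first unit vector. *)
have {M hM} [u0 hu] : 0 < fine (opnorm_U toR U) /\
    forall a, c0 a -> (forall n, nrm (a n) <= 1) -> nrm (U a) <= fine (opnorm_U toR U).
  have [||_ _ h1 h2] := @ereal_sup_fin R
      [set (toR `|U a|)%:E | a in [set a | c0 a /\ (supnorm toR a <= 1)%E]]
      `|M| (nrm (U (unit_seq 0))).
  - move=> _ [a [ha a1] <-]; have := hM a ha; move: a1.
    rewrite c0_supnorm// !lee_fin => a1 /le_trans; apply.
    rewrite -[leRHS]mulr1; apply: (@le_trans _ _ (`|M| * snorm a)).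
      by rewrite ler_wpM2r ?snorm_ge0// ler_norm.
    by rewrite ler_wpM2l.
  - exists (nrm (U (unit_seq 0)))%:E => //; exists (unit_seq 0) => //.
    split; first exact: c0_unit_seq.
    by apply/supnorm_leP => n; exact: nrm_unit_seq.
  split; last first.
    move=> a ha a1; rewrite -lee_fin; apply: h2; exists a => //; split=> //.
    exact/supnorm_leP.
  apply: lt_le_trans h1; rewrite lt_def (nrm_ge0 hR) andbT.
  apply/eqP => /(nrm0_eq0 hR) Ue; have := congr1 (V \o T) Ue.
  rewrite /= -(c0_map0 linU) !VTU//; [|exact: c0_zero|exact: c0_unit_seq].
  by move/(congr1 (@^~ 0%N))/eqP; rewrite /unit_seq eqxx oner_eq0.
(* The sequence [V (T (U a)) = a] has an entry 1, so its norm is at least 1; the bound for [V] is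
   applied to [T (U a)] scaled to norm 1. *)
have {M' hM'} hv a n : c0 a -> a n = 1 ->
    1 <= fine (opnorm_V toR V (T @` X0)) * nrm (T (U a)).
  move=> ha an.
  have [||_ _ h1 h2] := @ereal_sup_fin R
      [set supnorm toR (V y) | y in [set y | (T @` X0) y /\ `|y| <= 1]] `|M'| 0.
  - move=> _ [y [Xy y1] <-]; apply: le_trans (hM' y Xy) _; rewrite lee_fin.
    have {}y1 : toR `|y| <= 1.
      by rewrite -(nrm1 hR) (ler_nrm hR) normr1.
    rewrite -[leRHS]mulr1; apply: (@le_trans _ _ (`|M'| * toR `|y|)).
      by rewrite ler_wpM2r ?ler_norm//; exact: (nrm_ge0 hR).
    by rewrite ler_wpM2l.
  - exists (supnorm toR (V (T (U (fun=> 0))))).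
      exists (T (U (fun=> 0))) => //; split.
        by exists (U (fun=> 0)) => //; apply: U0; exact: c0_zero.
      by rewrite c0_map0// (lin0 linT) normr0 ler01.
    rewrite VTU; last exact: c0_zero.
    by rewrite c0_supnorm ?lee_fin ?snorm_ge0//; exact: c0_zero.
  set d := nrm _; have d0 : 0 < d.
    rewrite lt_def (nrm_ge0 hR) andbT; apply/eqP => /(nrm0_eq0 hR) TUa.
    have := congr1 V TUa; rewrite -(lin0 linT) -(c0_map0 linU) !VTU//; last exact: c0_zero.
    by move/(congr1 (@^~ n))/eqP; rewrite an oner_eq0.
  pose b m := ofR d^-1 * a m.
  have hb : c0 b.
    have := c0_lin (ofR d^-1) ha c0_zero; congr c0.
    by apply/funext => m; rewrite addr0.
  rewrite -ler_pdivrMr// mul1r.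
  have bn : nrm (b n) = d^-1.
    by rewrite /b an mulr1 (nrm_ofR hR)// invr_ge0 ltW.
  rewrite -bn; move: {bn} n {an}; apply/supnorm_leP; apply: h2.
  exists (T (U b)); last by rewrite VTU.
  split; first by exists (U b) => //; exact: U0.
  rewrite c0_mapZ// (linZ linT) -[leRHS]normr1 -(ler_nrm hR) (nrm1 hR) (nrmZ hR).
  by rewrite (nrm_ofR hR) ?invr_ge0 ?(ltW d0)// mulVf// gt_eqF.
set u := fine _ in u0 hu *; set v := fine _ in hv *.
have v0 : 0 < v.
  have := hv _ 0%N (c0_unit_seq 0); rewrite /unit_seq eqxx => /(_ erefl) h.
  have : 0 < v * nrm (T (U (unit_seq 0))) by exact: lt_le_trans h.
  rewrite !ltNge; apply: contra => v0; apply: mulr_le0_ge0 v0 _; exact: (nrm_ge0 hR).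
apply: le_trans (ereal_sup_ubound _); last first.
  exists (fun n => (ofR u)^-1 *: U (unit_seq n)) => //.
  exact: weakly_summable_unit_seq.
apply: le_ereal_inf_tmp => _ [n _ <-].
(* Consecutive partial sums differ by the single term of index [n.+1], whose norm is at least
   [(u * v)^-1]. *)
apply: le_trans (ereal_sup_ubound _); last first.
  by exists n.+1, n; split.
have sumB (F : nat -> Y) : \sum_(i < n.+2) F i - \sum_(i < n.+1) F i = F n.+1.
  by rewrite big_ord_recr/= addrAC subrr add0r.
rewrite /= lee_fin (sumB (fun i => T ((ofR u)^-1 *: U (unit_seq i)))).
rewrite (linZ linT) -/(nrm _) (nrmZ hR) -fmorphV (nrm_ofR hR) ?invr_ge0 ?(ltW u0)//.
rewrite invfM ler_pM2l ?invr_gt0// -[leLHS]mul1r ler_pdivrMr// mulrC.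
by apply: (hv _ n.+1); [exact: c0_unit_seq|rewrite /unit_seq eqxx].
Qed.

End c0_sequences.

(** * Weakly unconditionally Cauchy series *)

Lemma archi_inv (R : realType) (e : R) : 0 < e ->
  exists N, forall n, (N <= n)%N -> n.+1%:R^-1 <= e.
Proof.
move=> e0; exists (Num.truncn e^-1) => n Nn.
rewrite invf_ple ?posrE//; apply: ltW; apply: lt_le_trans (truncnS_gt _) _.
by rewrite ler_nat.
Qed.

Section weakly_summable.
Variables (R : realType) (K : numFieldType) (toR : K -> R).
Variables (ofR : {rmorphism R -> K}) (hR : real_part toR ofR).
Local Notation nrm := (@realnorm R K toR _).

Lemma weakly_summable_uniq (X : normedModType K) (y : nat -> X) f t :
  weakly_summable_le1 y -> dual_ball f -> uniq t ->
  \sum_(i <- t) `|f (y i)| <= 1.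
Proof.
move=> hy hf ut; apply: le_trans (hy f hf (\max_(i <- t) i).+1).
apply: (ler_sum_uniq (F := fun i => `|f (y i)|)) => // i it.
by rewrite ltnS; apply: (leq_bigmax_seq (F := id)).
Qed.

Lemma weakly_summable_uniq_nrm (X : normedModType K) (y : nat -> X) f t :
  weakly_summable_le1 y -> dual_ball f -> uniq t ->
  \sum_(i <- t) nrm (f (y i)) <= 1.
Proof.
move=> hy hf ut; rewrite -(ler_ofR hR) rmorph1 rmorph_sum/=.
under eq_bigr do rewrite (ofR_nrm hR).
exact: weakly_summable_uniq.
Qed.

Lemma weakly_summable_inj (X : normedModType K) (y : nat -> X) s :
  weakly_summable_le1 y -> injective s -> weakly_summable_le1 (y \o s).
Proof.
move=> hy sI f hf N; rewrite -(big_mkord xpredT (fun n => `|f (y (s n))|)).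
rewrite -(big_map s xpredT (fun n => `|f (y n)|)).
by apply: weakly_summable_uniq; rewrite ?map_inj_uniq ?iota_uniq.
Qed.

Hypothesis norming : forall (X : normedModType K) (x : X),
  exists f, dual_ball f /\ `|f x| = `|x|.

(** A functional norming the combination reduces the claim to the scalar sum of [|f (y i)|], which
    is at most 1. Hence summing [c i *: y i] has norm at most 1 on finitely supported sequences of
    c0. *)
Lemma weakly_summable_comb (X : normedModType K) (y : nat -> X) t
    (c : nat -> K) (s : R) :
  weakly_summable_le1 y -> uniq t -> 0 <= s ->
  (forall i, i \in t -> nrm (c i) <= s) ->
  nrm (\sum_(i <- t) c i *: y i) <= s.
Proof.
move=> hy ut s0 hc; have [f [hf fE]] := norming (\sum_(i <- t) c i *: y i).
rewrite {1}/realnorm -fE -/(nrm _) (lin_sum (Y := K^o) hf.1).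
apply: le_trans (ler_nrm_sum hR _ _ _) _.
apply: (@le_trans _ _ (\sum_(i <- t) s * nrm (f (y i)))).
  rewrite big_seq [leRHS]big_seq; apply: ler_sum => i it.
  rewrite (linZ (Y := K^o) hf.1) (nrmM hR) ler_wpM2r ?hc//.
  exact: (nrm_ge0 hR).
rewrite -mulr_sumr ler_piMr//; exact: weakly_summable_uniq_nrm.
Qed.

(** The blocks are chosen recursively, the next one starting at or after the end [c n] of the blocks
    already chosen. They are disjoint, so the values of [f] on blocks are dominated by its values on
    the terms of [x]. *)
Lemma weakly_summable_blocks (X : normedModType K) (x : nat -> X)
    (P : X -> Prop) :
  weakly_summable_le1 x ->
  (forall n, exists l k, (n <= l <= k)%N /\ P (\sum_(l <= i < k) x i)) ->
  exists y, weakly_summable_le1 y /\ forall j, P (y j).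
Proof.
move=> hx hP.
have {}hP n : exists p : nat * nat, (n <= p.1 <= p.2)%N /\
    P (\sum_(p.1 <= i < p.2) x i).
  by have [l [k h]] := hP n; exists (l, k).
have [p hp] := choice hP.
pose c := fix c n := if n is n'.+1 then (p (c n')).2 else 0%N.
exists (fun j => \sum_((p (c j)).1 <= i < (p (c j)).2) x i).
split=> [f hf N|j]; last exact: (hp _).2.
apply: le_trans (hx f hf (c N)).
rewrite -(big_mkord xpredT (fun n => `|f (x n)|)).
elim: N => [|N IH]; first by rewrite big_ord0 sumr_ge0.
have /andP[h1 h2] := (hp (c N)).1.
rewrite big_ord_recr/= [leRHS](big_cat_nat (n := (p (c N)).1))//=.
apply: lerD.
  apply: le_trans IH _.
  by rewrite [leRHS](big_cat_nat (n := c N))//= lerDl sumr_ge0.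
rewrite (lin_sum (Y := K^o) hf.1); exact: ler_norm_sum.
Qed.

End weakly_summable.

(** * Embedding c0 *)

Section embedding.
Variables (R : realType) (K : numFieldType) (toR : K -> R).
Variables (ofR : {rmorphism R -> K}) (hR : real_part toR ofR).
Local Notation nrm := (@realnorm R K toR _).
Local Notation snorm := (@snorm R K toR).

Hypothesis norming : forall (X : normedModType K) (x : X),
  exists f, dual_ball f /\ `|f x| = `|x|.
Hypothesis complete_K : forall u : nat -> K,
  ecauchy toR u -> exists l, econv toR u l.

Variables (X Y : completeNormedModType K) (T : X -> Y) (M : R).
Hypothesis linT : is_linear T.
Hypothesis M_gt0 : 0 < M.
Hypothesis boundT : forall x, nrm (T x) <= M * nrm x.

Variables (y : nat -> X) (d e : R).
Hypothesis summable_y : weakly_summable_le1 y.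
Hypothesis e_ge0 : 0 <= e.
Hypothesis e_lt_d : e < d.

Definition psum (a : nat -> K) N := \sum_(i < N) a i *: y i.

(** This is the estimate that Rosenthal's lemma supplies in [weakly_summable_lower]. *)
Hypothesis lower_psum : forall a s N n, (forall i, nrm (a i) <= s) ->
  (n < N)%N -> d * nrm (a n) - e * s <= nrm (T (psum a N)).

(** The sum of the series of [a i *: y i]. The default 0 is taken only when the series diverges,
    which never happens on c0. *)
Definition c0_embed (a : nat -> K) : X := xget 0 [set x | econv toR (psum a) x].
Local Notation U := c0_embed.

(** A block of the series has norm at most the largest coefficient in it, and these tend to 0. *)
Lemma c0_embedP a : c0 a -> econv toR (psum a) (U a).
Proof.
move=> /(c0P hR) ha; suff /cid[x hx] : exists x, econv toR (psum a) x.
  exact: (xgetPex 0 (ex_intro _ x hx)).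
apply: (ecauchy_cvg hR) => r r0; have [N hN] := ha r r0.
exists N => m n; wlog mn : m n / (n <= m)%N => [H|] Nm Nn.
  by case/orP: (leq_total n m) => h; [|rewrite nrmBC]; exact: H.
rewrite /psum -!(big_mkord xpredT (fun i => a i *: y i)).
rewrite (big_cat_nat (n := n))//= addrAC subrr add0r.
apply: (weakly_summable_comb hR norming) => //; [exact: iota_uniq|exact: ltW|].
move=> i; rewrite mem_index_iota => /andP[ni _].
by rewrite -[a i]subr0 hN// (leq_trans Nn).
Qed.

Lemma c0_embed_lin k a b : c0 a -> c0 b ->
  U (fun n => k * a n + b n) = k *: U a + U b.
Proof.
move=> ha hb; apply: (econv_uniq hR (c0_embedP (c0_lin hR k ha hb))).
have := econvD hR (econvZ hR k (c0_embedP ha)) (c0_embedP hb).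
congr econv; apply/funext => N; rewrite /psum scaler_sumr -big_split/=.
by apply: eq_bigr => i _; rewrite scalerDl scalerA.
Qed.

Lemma nrm_c0_embed a : c0 a -> nrm (U a) <= snorm a.
Proof.
move=> ha; apply: (econv_nrm_le hR (N := 0) (c0_embedP ha)) => N _.
rewrite /psum -(big_mkord xpredT (fun i => a i *: y i)).
apply: (weakly_summable_comb hR norming) => //; first exact: iota_uniq.
  exact: snorm_ge0 hR _ ha.
by move=> i _; exact: nrm_le_snorm hR _ _ ha.
Qed.

(** Let [N] tend to infinity in [lower_psum] with [s = snorm a], then take the supremum over [n]. *)
Lemma snorm_le_nrm_embed a : c0 a -> (d - e) * snorm a <= nrm (T (U a)).
Proof.
move=> ha; have d0 : 0 < d by exact: le_lt_trans e_lt_d.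
have convT : econv toR (fun N => T (psum a N)) (T (U a)).
  move=> r r0; have [N hN] := c0_embedP ha (divr_gt0 r0 M_gt0).
  exists N => n Nn; rewrite -(linB linT) (le_trans (boundT _))//.
  by rewrite mulrC -ler_pdivlMr// hN.
have h n : d * nrm (a n) - e * snorm a <= nrm (T (U a)).
  apply: (econv_nrm_ge hR (N := n.+1) convT) => N nN.
  by apply: lower_psum => // i; exact: nrm_le_snorm hR _ _ ha.
have : snorm a <= (nrm (T (U a)) + e * snorm a) / d.
  apply: (snorm_le hR ha) => n; rewrite ler_pdivlMr// mulrC.
  by rewrite -lerBlDr.
by rewrite ler_pdivlMr// mulrBl lerBlDr mulrC.
Qed.

Lemma snorm_le_dist a b : c0 a -> c0 b -> forall n,
  nrm (a n - b n) <= (M / (d - e)) * nrm (U a - U b).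
Proof.
move=> ha hb n; pose c n := (-1) * b n + a n.
have hc : c0 c by exact: (c0_lin hR).
have -> : a n - b n = c n by rewrite /c mulN1r addrC.
have -> : U a - U b = U c by rewrite c0_embed_lin// scaleN1r addrC.
apply: le_trans (nrm_le_snorm hR n hc) _.
rewrite mulrAC ler_pdivlMr ?subr_gt0// mulrC.
exact: le_trans (snorm_le_nrm_embed hc) (boundT _).
Qed.

Lemma c0_embed_inj a b : c0 a -> c0 b -> T (U a) = T (U b) -> a = b.
Proof.
move=> ha hb TE; pose c n := (-1) * b n + a n.
have hc : c0 c by exact: (c0_lin hR).
have := snorm_le_nrm_embed hc; rewrite c0_embed_lin// linT TE scaleN1r addNr.
rewrite (nrm0 hR) pmulr_rle0 ?subr_gt0// => sc0; apply/funext => n.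
apply/eqP; rewrite -subr_eq0; apply/eqP/(nrm0_eq0 hR)/eqP.
rewrite eq_le (nrm_ge0 hR) andbT (le_trans _ sc0)//.
by rewrite addrC -mulN1r; exact: (nrm_le_snorm hR n hc).
Qed.

(** If [U (A k)] tends to [x], the lower estimate makes the sequences [A k] Cauchy uniformly in the
    coordinates. Their coordinatewise limit is therefore uniform and lies in c0, and boundedness of
    [U] identifies its image with [x]. *)
Lemma closed_c0_embed : closed (U @` (@c0 K)).
Proof.
move=> x clx; set C := M / (d - e).
have C0 : 0 < C by rewrite divr_gt0// subr_gt0.
pose r k : R := k.+1%:R^-1.
have r0 k : 0 < r k by rewrite invr_gt0.
have rle k l : (k <= l)%N -> r l <= r k.
  by move=> kl; rewrite lef_pV2 ?posrE// ler_nat.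
have {}clx k : exists a, c0 a /\ nrm (x - U a) <= r k.
  have [_ [[a ha <-]]] := clx _ (nbhsx_ballx x _ (ofR_gt0 hR (r0 k))).
  rewrite -ball_normE /= => xa; exists a; split => //.
  by rewrite -(ler_ofR hR) (ofR_nrm hR) ltW.
have [A hA] := choice clx.
have c0A k : c0 (A k) := (hA k).1.
have distA k l n : (k <= l)%N -> nrm (A k n - A l n) <= 2 * C * r k.
  move=> kl; apply: le_trans (snorm_le_dist (c0A k) (c0A l) n) _.
  rewrite -/C [2 * C]mulrC -[C * 2 * _]mulrA ler_pM2l// mulr_natl mulr2n.
  apply: le_trans (ler_nrm_dist hR x _ _) _; rewrite nrmBC.
  by apply: lerD; [exact: (hA k).2|exact: le_trans (hA l).2 (rle _ _ kl)].
have small q : 0 < q -> exists k, 2 * C * r k <= q.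
  move=> q0; have C2 : 0 < 2 * C by rewrite mulr_gt0.
  have [k hk] := archi_inv (divr_gt0 q0 C2).
  by exists k; rewrite mulrC -ler_pdivlMr// hk.
have /choice[a ha] : forall n, exists l, econv toR (fun k => A k n) l.
  move=> n; apply: complete_K => q q0; have [k hk] := small (q / 2) (divr_gt0 q0 (ltr0Sn _ 1)).
  exists k => i j ki kj; apply: le_trans (ler_nrm_dist hR (A k n) _ _) _.
  rewrite [q]splitr lerD// (le_trans _ hk)// ?distA//.
  by rewrite nrmBC distA.
have distAa k n : nrm (A k n - a n) <= 2 * C * r k.
  have hc : econv toR (fun l => A k n - A l n) (A k n - a n).
    move=> q q0; have [N hN] := ha n q q0; exists N => l Nl.
    by rewrite opprB addrC addrA subrK nrmBC hN.
  by apply: (econv_nrm_le hR (N := k) hc) => l; exact: distA.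
have c0a : c0 a.
  apply/(c0P hR) => q q0; have [k hk] := small (q / 2) (divr_gt0 q0 (ltr0Sn _ 1)).
  have [N hN] := proj1 (c0P hR _) (c0A k) (q / 2) (divr_gt0 q0 (ltr0Sn _ 1)).
  exists N => n Nn; apply: le_trans (ler_nrm_dist hR (A k n) _ _) _.
  rewrite [q]splitr lerD ?hN// nrmBC.
  exact: le_trans (distAa k n) hk.
exists a => //; apply/esym/eqP; rewrite -subr_eq0; apply/eqP/(nrm0_eq0 hR)/eqP.
rewrite eq_le (nrm_ge0 hR) andbT; apply/ler_addgt0Pr => q q0; rewrite add0r.
have [k hk] := small (q / 2) (divr_gt0 q0 (ltr0Sn _ 1)).
have [l hl] := archi_inv (divr_gt0 q0 (ltr0Sn _ 1)).
(* Here [l] controls the distance from [x] to [U (A m)], and [k] that from [A m] to [a]. *)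
pose m := maxn k l.
apply: le_trans (ler_nrm_dist hR (U (A m)) _ _) _.
rewrite [q]splitr; apply: lerD.
  by apply: le_trans (hA m).2 _; apply: hl; exact: leq_maxr.
have -> : U (A m) - U a = U (fun n => (-1) * a n + A m n).
  by rewrite c0_embed_lin// scaleN1r addrC.
apply: le_trans (nrm_c0_embed _) _; first exact: (c0_lin hR).
apply: (snorm_le hR); first exact: (c0_lin hR).
move=> n; rewrite mulN1r addrC; apply: le_trans (distAa m n) _.
apply: le_trans hk; rewrite (ler_pM2l (mulr_gt0 (ltr0Sn _ 1) C0)).
by apply: rle; exact: leq_maxl.
Qed.

(** Take for [X0] the range of [U] and for [V] the inverse of [T \o U]. The norm of [U] is at most 1
    and that of [V] at most [(d - e)^-1]. *)
Lemma fix_c0_vals_embed : exists2 r : R, d - e <= r & fix_c0_vals toR T r%:E.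
Proof.
have de0 : 0 < d - e by rewrite subr_gt0.
pose X0 := U @` (@c0 K).
pose V z := xget (fun=> 0) [set a | c0 a /\ T (U a) = z].
have VTU a : c0 a -> V (T (U a)) = a.
  move=> ha; have [|hv TV] := @xgetPex _ (fun=> 0) [set b | c0 b /\ T (U b) = T (U a)].
    by exists a.
  exact: c0_embed_inj TV.
have U_lower a : c0 a -> (d - e) / M * snorm a <= nrm (U a).
  move=> ha; rewrite mulrAC ler_pdivrMr// [leRHS]mulrC.
  exact: le_trans (snorm_le_nrm_embed ha) (boundT _).
have V_upper a : c0 a -> snorm a <= (d - e)^-1 * nrm (T (U a)).
  by move=> ha; rewrite ler_pdivlMl// snorm_le_nrm_embed.
have c0e := c0_unit_seq hR 0; set e0 := unit_seq K 0 in c0e.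
have e0E : e0 0%N = 1 by rewrite /e0 /unit_seq eqxx.
have nrm_e0 n : nrm (e0 n) <= 1 by exact: nrm_unit_seq hR _ _.
have snorm_e0 : snorm e0 = 1.
  have := nrm_le_snorm hR 0 c0e; rewrite e0E (nrm1 hR) => h1.
  by apply/eqP; rewrite eq_le (snorm_le hR c0e nrm_e0).
have TUe0 : 0 < nrm (T (U e0)).
  by apply: lt_le_trans (snorm_le_nrm_embed c0e); rewrite snorm_e0 mulr1.
have Ue0 : 0 < nrm (U e0).
  by rewrite -(pmulr_rgt0 _ M_gt0); apply: lt_le_trans TUe0 (boundT _).
(* The first unit vector gives positive lower bounds for both operator norms, so that inverting
   their product reverses the inequality. *)
have [||_ oU1 oU0 _] := @ereal_sup_fin R
    [set (toR `|U a|)%:E | a in [set a | c0 a /\ (supnorm toR a <= 1)%E]]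
    1 (nrm (U e0)).
- move=> _ [a [ha a1] <-]; rewrite lee_fin (le_trans (nrm_c0_embed ha))//.
  by move: a1; rewrite (c0_supnorm hR ha) lee_fin.
- exists (nrm (U e0))%:E => //; exists e0 => //.
  by split=> //; rewrite (c0_supnorm hR c0e) snorm_e0.
have [||_ oV1 oV0 _] := @ereal_sup_fin R
    [set supnorm toR (V z) | z in [set z | (T @` X0) z /\ `|z| <= 1]]
    (d - e)^-1 (nrm (T (U e0)))^-1.
- move=> _ [_ [[_ [a ha <-] <-] Ta1] <-]; rewrite VTU// (c0_supnorm hR ha) lee_fin.
  apply: le_trans (V_upper a ha) _; rewrite -[leRHS]mulr1 ler_pM2l ?invr_gt0//.
  by rewrite -(nrm1 hR) (ler_nrm hR) normr1.
- pose a n := ofR (nrm (T (U e0)))^-1 * e0 n.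
  have aE : a = fun n => ofR (nrm (T (U e0)))^-1 * e0 n + 0.
    by apply/funext => n; rewrite addr0.
  have ha : c0 a by rewrite aE; apply: (c0_lin hR) => //; exact: c0_zero hR.
  exists (supnorm toR (V (T (U a)))); last first.
    rewrite VTU// (c0_supnorm hR ha) lee_fin.
    apply: le_trans (nrm_le_snorm hR 0 ha).
    by rewrite /a e0E mulr1 (nrm_ofR hR)// invr_ge0 ltW.
  exists (T (U a)) => //; split; first by exists (U a) => //; exists a.
  rewrite (c0_mapZ hR c0_embed_lin)// (linZ linT) -[leRHS]normr1 -(ler_nrm hR).
  rewrite (nrm1 hR) (nrmZ hR) (nrm_ofR hR) ?invr_ge0 ?(ltW TUe0)//.
  by rewrite mulVf// gt_eqF.
exists (fine (opnorm_U toR U) * fine (opnorm_V toR V (T @` X0)))^-1.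
  rewrite -[leLHS]invrK lef_pV2 ?posrE ?invr_gt0//; last first.
    rewrite mulr_gt0//; first exact: lt_le_trans oU0.
    by apply: lt_le_trans oV0; rewrite invr_gt0.
  rewrite -[leRHS]mul1r ler_pM//; first exact: le_trans (ltW Ue0) oU0.
  by apply: le_trans oV0; rewrite invr_ge0 ltW.
exists X0, U, V; split; [|split; [|split; [|split; [|split]]]] => //.
- split; first by exists (fun=> 0); [exact: (c0_zero hR)|exact: (c0_map0 hR c0_embed_lin)].
  split; last exact: closed_c0_embed.
  move=> k _ _ [a ha <-] [b hb <-]; exists (fun n => k * a n + b n).
    exact: c0_lin hR _ _ _ ha hb.
  exact: c0_embed_lin.
- split.
    move=> _ _ /set_mem[a ha <-] /set_mem[b hb <-] TE.
    by congr U; exact: c0_embed_inj TE.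
  exists (ofR (d - e)); split; first exact: ofR_gt0 hR _ de0.
  move=> _ [a ha <-]; rewrite -!(ofR_nrm hR) -rmorphM (ler_ofR hR).
  apply: le_trans (snorm_le_nrm_embed ha).
  by rewrite ler_pM2l// nrm_c0_embed.
- split; first by move=> a ha; exists a.
  split; first exact: c0_embed_lin.
  split.
    move=> a b /set_mem ha /set_mem hb UE.
    by apply: c0_embed_inj => //; rewrite UE.
  split; first by move=> _ [a ha <-]; exists a.
  split.
    exists 1 => a ha; rewrite mul1e (c0_supnorm hR ha) lee_fin.
    exact: nrm_c0_embed.
  exists ((d - e) / M); split; first by rewrite divr_gt0.
  by move=> a ha; rewrite (c0_supnorm hR ha) -EFinM lee_fin; exact: U_lower.
- split; first by move=> _ [_ [a ha <-] <-]; rewrite VTU.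
  split.
    move=> k _ _ [_ [a ha <-] <-] [_ [b hb <-] <-].
    rewrite -linT -c0_embed_lin// !VTU//; exact: c0_lin hR _ _ _ ha hb.
  split.
    move=> _ _ /set_mem[_ [a ha <-] <-] /set_mem[_ [b hb <-] <-].
    by rewrite !VTU// => ->.
  split; first by move=> a ha; exists (T (U a)); [exists (U a) => //; exists a|exact: VTU].
  split.
    exists (d - e)^-1 => _ [_ [a ha <-] <-].
    by rewrite VTU// (c0_supnorm hR ha) lee_fin; exact: V_upper.
  exists M^-1; split; first by rewrite invr_gt0.
  move=> _ [_ [a ha <-] <-]; rewrite VTU// (c0_supnorm hR ha) lee_fin.
  rewrite ler_pdivrMl//; apply: le_trans (boundT _) _.
  by rewrite ler_pM2l// nrm_c0_embed.
- by move=> _ [a ha <-]; rewrite VTU.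
Qed.

End embedding.

(** * The lower bound *)

Section uc_le_fix_c0.
Variables (R : realType) (K : numFieldType) (toR : K -> R).
Variables (ofR : {rmorphism R -> K}) (hR : real_part toR ofR).
Local Notation nrm := (@realnorm R K toR _).

Hypothesis norming : forall (X : normedModType K) (x : X),
  exists f, dual_ball f /\ `|f x| = `|x|.
Hypothesis complete_K : forall u : nat -> K,
  ecauchy toR u -> exists l, econv toR u l.

Variables (X Y : completeNormedModType K) (T : X -> Y) (M : R).
Hypothesis linT : is_linear T.
Hypothesis M_gt0 : 0 < M.
Hypothesis boundT : forall x, nrm (T x) <= M * nrm x.

Lemma weakly_summable_lower (x : nat -> X) (d e : R) : 0 < e ->
  weakly_summable_le1 x -> (forall n, d < nrm (T (x n))) ->
  exists y, weakly_summable_le1 y /\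
    forall a s N n, (forall i, nrm (a i) <= s) -> (n < N)%N ->
      d * nrm (a n) - e * s <= nrm (T (psum y a N)).
Proof.
move=> e0 hx dx.
have /choice[g hg] : forall n, exists f, dual_ball f /\ `|f (T (x n))| = `|T (x n)|.
  by move=> n; exact: norming.
pose A n m := nrm (g n (T (x m))).
have hA n t : uniq t -> \sum_(m <- t) A n m <= M.
  (* The functional [g n \o T] divided by [M] lies in the dual ball, so weak summability bounds the
     row sums by [M]. *)
  move=> ut; pose f z := ofR M^-1 * g n (T z).
  have hf : dual_ball f.
    split=> [a z w|z].
      by rewrite /f linT (hg n).1.1 mulrDr mulrCA.
    rewrite -(ler_nrm hR) (nrmM hR) (nrm_ofR hR) ?invr_ge0 ?(ltW M_gt0)//.
    rewrite ler_pdivrMl//; apply: le_trans (boundT _).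
    exact: nrm_dual_ball hR _ _ _ (hg n).1.
  have := weakly_summable_uniq_nrm hR hx hf ut.
  under eq_bigr do rewrite (nrmM hR) (nrm_ofR hR) ?invr_ge0 ?(ltW M_gt0)//.
  by rewrite -mulr_sumr ler_pdivrMl// mulr1.
have [s [sI hs]] : exists s : nat -> nat, injective s /\
    forall n (t : seq nat), uniq t -> n \notin t -> \sum_(m <- t) A (s n) (s m) <= e.
  (* This number of multiples of [e] exceeds the bound [M] on the rows. *)
  apply: (@rosenthal _ e (Num.truncn (M / e)).+1 A (ltW e0)) => n t ut _.
  apply: le_trans (hA n t ut) _; rewrite -mulr_natr mulrC -ler_pdivrMr//.
  by rewrite ltW// truncnS_gt.
exists (x \o s); split; first exact: weakly_summable_inj.
move=> a c N n ac nN; set w := psum _ _ _.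
have c0 : 0 <= c by apply: le_trans (ac 0%N); exact: (nrm_ge0 hR).
apply: le_trans (nrm_dual_ball hR (T w) (hg (s n)).1).
have gE : g (s n) (T w) = \sum_(0 <= i < N) a i * g (s n) (T (x (s i))).
  rewrite /w /psum (lin_sum linT) (lin_sum (Y := K^o) (hg (s n)).1.1) big_mkord.
  apply: eq_bigr => i _.
  by rewrite (linZ linT) (linZ (Y := K^o) (hg (s n)).1.1).
(* The diagonal term has norm at least [d * nrm (a n)]; the remainder [r] is bounded by an
   off-diagonal row sum times [c]. *)
rewrite gE (bigD1_seq n) ?mem_index_iota ?iota_uniq//=; set r := \sum_(_ <- _ | _) _.
have rle : nrm r <= e * c.
  apply: le_trans (ler_nrm_sum hR _ _ _) _.
  apply: (@le_trans _ _ (c * \sum_(i <- index_iota 0 N | i != n) A (s n) (s i))).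
    rewrite mulr_sumr; apply: ler_sum => i _; rewrite (nrmM hR) ler_wpM2r//.
    exact: (nrm_ge0 hR).
  rewrite mulrC ler_wpM2r// -big_filter; apply: hs.
    by rewrite filter_uniq ?iota_uniq.
  by rewrite mem_filter eqxx.
have dle : d * nrm (a n) <= nrm (a n * g (s n) (T (x (s n)))).
  rewrite (nrmM hR) mulrC ler_wpM2l ?(nrm_ge0 hR)//.
  by rewrite /realnorm (hg (s n)).2 ltW// dx.
rewrite lerBlDr; apply: le_trans dle _.
rewrite -[X in nrm X <= _](addrK r); apply: le_trans (ler_nrmB hR _ _) _.
by rewrite lerD2l.
Qed.

(** Otherwise there are [d] and [e] with [fix_c0 < d - e] and [d < ca], and the copy of c0 built
    from blocks of norm above [d] under [T] gives a value at least [d - e]. *)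
Lemma ca_le_fix_c0 (x : nat -> X) : weakly_summable_le1 x ->
  (ca toR (fun n => \sum_(i < n.+1) T (x i))%R <= fix_c0 toR T)%E.
Proof.
move=> hx; rewrite leNgt; apply/negP => lt_ca.
have fix_ge0 : (0 <= fix_c0 toR T)%E.
  rewrite /fix_c0; case: ifPn => // /set0P[r hr].
  apply: le_trans (ereal_sup_ubound hr).
  move: hr => [X0 [U [V [[X00 _] [_ [_ [_ [_ ->]]]]]]]].
  have supnorm_ge0 (a : nat -> K) : (0 <= supnorm toR a)%E.
    apply: (@le_trans _ _ (nrm (a 0%N))%:E); first by rewrite lee_fin (nrm_ge0 hR).
    by apply: ereal_sup_ubound; exists 0%N.
  rewrite lee_fin invr_ge0 mulr_ge0// fine_ge0//.
    apply: (@le_trans _ _ (nrm (U (fun=> 0)))%:E); first by rewrite lee_fin (nrm_ge0 hR).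
    apply: ereal_sup_ubound; exists (fun=> 0) => //; split; first exact: (c0_zero hR).
    by apply/supnorm_leP => n; rewrite (nrm0 hR).
  apply: le_trans (supnorm_ge0 (V 0)) _; apply: ereal_sup_ubound; exists 0 => //.
  by split; [exists 0 => //; exact: (lin0 linT)|rewrite /= normr0].
have [d [e [e0 ed fix_lt lt_ca']]] : exists d e : R, [/\ 0 < e, e < d,
    (fix_c0 toR T < (d - e)%:E)%E &
    (d%:E < ca toR (fun n => \sum_(i < n.+1) T (x i))%R)%E].
  case: (fix_c0 toR T) fix_ge0 lt_ca => [f| |] // => [|_]; last by rewrite ltNge leey.
  rewrite lee_fin => f0 lt_ca.
  have [d fd dca] : exists2 d, f < d &
      (d%:E < ca toR (fun n => \sum_(i < n.+1) T (x i))%R)%E.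
    move: lt_ca; case: (ca _ _) => [c| |] // fc.
      by exists ((f + c) / 2); move: fc; rewrite !lte_fin; lra.
    by exists (f + 1); rewrite ?ltry// ltrDl.
  (* Here [d - e] is the midpoint of [f] and [d], and [e < d] because [0 <= f < d]. *)
  by exists d, ((d - f) / 2); split; rewrite ?lte_fin//; lra.
have [y [hy dy]] : exists y, weakly_summable_le1 y /\ forall j, d < nrm (T (y j)).
  apply: (weakly_summable_blocks (P := fun v => d < nrm (T v)) hx) => n.
  have : (d%:E < ereal_sup [set r | exists k l : nat, [/\ (n <= k)%N, (n <= l)%N &
      r = (nrm (\sum_(i < k.+1) T (x i) - \sum_(i < l.+1) T (x i))%R)%:E]])%E.
    by apply: lt_le_trans lt_ca' _; apply: ereal_inf_lbound; exists n.
  move=> /ereal_sup_gt[_ [k [l [nk nl ->]]]]; rewrite lte_fin => dkl.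
  wlog lk : k l nk nl dkl / (l <= k)%N => [H|].
    by case/orP: (leq_total l k) => h; [exact: (H k l)|apply: (H l k) => //; rewrite nrmBC].
  (* The partial sums include their last indices [k] and [l], so their difference runs over the
     half-open interval from [l.+1] to [k.+1]. *)
  exists l.+1, k.+1; split; first by rewrite ltnS lk andbT leqW.
  rewrite (lin_sum linT); move: dkl.
  by rewrite -!(big_mkord xpredT (fun i => T (x i))) (big_cat_nat (n := l.+1))//= addrAC subrr add0r.
have [z [hz lz]] := weakly_summable_lower e0 hy dy.
have [r rde hr] := fix_c0_vals_embed hR norming complete_K linT M_gt0 boundT hz
  (ltW e0) ed lz.
move: fix_lt; rewrite /fix_c0; case: ifPn => [/eqP v0|_].
  by move: hr; rewrite v0.
apply/negP; rewrite -leNgt; apply: le_trans (ereal_sup_ubound hr).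
by rewrite lee_fin.
Qed.

End uc_le_fix_c0.

(** * Real and complex scalars *)

Section real_scalars.
Variable R : realType.

Lemma real_part_id : real_part (fun r : R => r) (@idfun R : {rmorphism R -> R}).
Proof. by split. Qed.

Lemma norming_real (X : normedModType R) (x : X) :
  exists f, dual_ball f /\ `|f x| = `|x|.
Proof.
have [f [fD fZ fle fx]] := hahn_banach x (sublinear_nrm real_part_id X).
exists f; split; last by rewrite fx /realnorm normr_id.
split=> [a z w|z]; first by rewrite fD fZ.
rewrite ler_norml fle andbT lerNl.
have := fZ (-1) z; rewrite scaleN1r mulN1r => <-.
by apply: le_trans (fle _) _; rewrite /realnorm normrN.
Qed.

Lemma complete_real (u : nat -> R) : ecauchy (fun r : R => r) u ->
  exists l, econv (fun r : R => r) u l.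
Proof. exact: (ecauchy_cvg real_part_id (V := R^o)). Qed.

End real_scalars.

Section complex_scalars.
Variable R : realType.
Local Notation Re := (@complex.Re R).
Local Notation ofR := (real_complex R).

Lemma real_part_Re : real_part Re (ofR : {rmorphism R -> R[i]}).
Proof.
split=> //.
- by move=> x /ger0_Im; case: x => a b /= ->.
- by move=> [a b] [c d].
- by move=> r [a b] /=; rewrite mul0r subr0.
- by move=> [a b] [c d]; rewrite lecE => /andP[].
- by move=> r s; rewrite lecR.
Qed.

Lemma normr_Re_le (z : R[i]) : `|Re z| <= realnorm Re z.
Proof. by rewrite -lecR (ofR_nrm real_part_Re); exact: normc_ge_Re. Qed.

Lemma nrm_i : realnorm Re 'i%C = 1.
Proof. by rewrite /realnorm normc_def /= expr0n add0r expr1n sqrtr1. Qed.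

Lemma normr_Im_le (z : R[i]) : `|complex.Im z| <= realnorm Re z.
Proof.
have := normr_Re_le (z * 'i%C).
rewrite ReiNIm normrN (nrmM real_part_Re) => /le_trans; apply.
by rewrite nrm_i mulr1.
Qed.

Lemma nrm_le_ReIm (z : R[i]) : realnorm Re z <= `|Re z| + `|complex.Im z|.
Proof.
rewrite {1}[z]complexE; apply: le_trans (ler_nrmD real_part_Re _ _) _.
rewrite (nrmM real_part_Re) nrm_i mul1r.
by rewrite /realnorm !normc_def /= !(expr0n, addr0) !sqrtr_sqr.
Qed.

(** Extend over the reals first; [g z = f z - i f (i z)] is then complex linear with real part [f].
    Rotating [z] so that [g z] becomes its absolute value turns the bound on [f] into one on [g]. *)
Lemma norming_complex (X : normedModType R[i]) (x : X) :
  exists f, dual_ball f /\ `|f x| = `|x|.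
Proof.
have [f [fD fZ fle fx]] := hahn_banach x (sublinear_nrm real_part_Re X).
pose j : R[i] := 'i%C.
pose g z : R[i] := (f z +i* - f (j *: z))%C.
have fC (a b : R) z : f ((a +i* b)%C *: z) = a * f z + b * f (j *: z).
  have -> : (a +i* b)%C = ofR a + ofR b * j.
    by apply/eqP; rewrite eq_complex /=; apply/andP; split; apply/eqP; ring.
  by rewrite scalerDl -scalerA fD !fZ.
have fjj z : f (j *: (j *: z)) = - f z.
  have -> : j *: (j *: z) = ofR (-1) *: z.
    rewrite scalerA; congr (_ *: _).
    by apply/eqP; rewrite eq_complex /=; apply/andP; split; apply/eqP; ring.
  by rewrite fZ mulN1r.
have gZ a z : g (a *: z) = a * g z.
  case: a => a b; rewrite /g scalerA mulrC -scalerA (fC a b z) (fC a b (j *: z)) fjj.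
  by apply/eqP; rewrite eq_complex /=; apply/andP; split; apply/eqP; ring.
have gD z w : g (z + w) = g z + g w.
  rewrite /g scalerDr !fD.
  by apply/eqP; rewrite eq_complex /=; apply/andP; split; apply/eqP; ring.
have gle z : realnorm Re (g z) <= realnorm Re z.
  have [->|gz0] := eqVneq (g z) 0.
    by rewrite (nrm0 real_part_Re) (nrm_ge0 real_part_Re).
  have := fle ((`|g z| / g z) *: z).
  rewrite (nrmZ real_part_Re) (nrm_norm_div real_part_Re)// mul1r.
  suff <- : realnorm Re (g z) = f ((`|g z| / g z) *: z) by [].
  by rewrite /realnorm -[in LHS](divfK gz0 `|g z|) -gZ.
exists g; split.
  split=> [a z w|z]; first by rewrite gD gZ.
  by rewrite -(ler_nrm real_part_Re).
apply/eqP; rewrite eq_le -!(ler_nrm real_part_Re) gle/= -fx.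
by apply: le_trans (normr_Re_le (g x)); rewrite ler_norm.
Qed.

Lemma complete_complex (u : nat -> R[i]) : ecauchy Re u ->
  exists l, econv Re u l.
Proof.
move=> hu.
have [|a ha] := @complete_real R (fun n => Re (u n)).
  move=> e /hu[N hN]; exists N => m n Nm Nn; apply: le_trans (hN m n Nm Nn).
  by rewrite -raddfB; exact: normr_Re_le.
have [|b hb] := @complete_real R (fun n => complex.Im (u n)).
  move=> e /hu[N hN]; exists N => m n Nm Nn; apply: le_trans (hN m n Nm Nn).
  by rewrite -raddfB; exact: normr_Im_le.
exists (a +i* b)%C => e e0.
have [N hN] := ha (e / 2) (divr_gt0 e0 (ltr0Sn _ 1)).
have [M hM] := hb (e / 2) (divr_gt0 e0 (ltr0Sn _ 1)).
exists (maxn N M) => n; rewrite geq_max => /andP[Nn Mn].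
apply: le_trans (nrm_le_ReIm _) _; rewrite [e]splitr.
by case: (u n) (hN n Nn) (hM n Mn) => p q /= h1 h2; exact: lerD.
Qed.

End complex_scalars.

(** * Both inequalities over an abstract scalar field *)

Section main.
Variables (R : realType) (K : numFieldType) (toR : K -> R).
Variables (ofR : {rmorphism R -> K}) (hR : real_part toR ofR).
Local Notation nrm := (@realnorm R K toR _).

Lemma is_bounded_nrm (X Y : normedModType K) (T : X -> Y) : is_bounded T ->
  exists2 M : R, 0 < M & forall x, nrm (T x) <= M * nrm x.
Proof.
(* The bound is an element of [K], so its norm is used; adding 1 makes it positive. *)
move=> [M hM]; exists (nrm M + 1) => [|x]; first by rewrite ltr_wpDl ?(nrm_ge0 hR).
have h := hM x; have Mx0 : 0 <= M * `|x| by exact: le_trans h.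
apply: (@le_trans _ _ (nrm M * nrm x)).
  by rewrite -(ler_ofR hR) rmorphM !(ofR_nrm hR) -[`|x|]normr_id -normrM ger0_norm.
by rewrite ler_wpM2r ?(nrm_ge0 hR)// lerDl.
Qed.

(** The zero sequence is admissible, and each supremum in [ca] contains a norm. *)
Lemma uc_ge0 (X Y : normedModType K) (T : X -> Y) : (0 <= uc toR T)%E.
Proof.
apply: (@le_trans _ _ (ca toR (fun n => \sum_(i < n.+1) T 0)%R)).
  apply: le_ereal_inf_tmp => _ [n _ <-].
  apply: (@le_trans _ _ (toR `|\sum_(i < n.+1) T 0 - \sum_(i < n.+1) T 0|%R)%:E).
    by rewrite lee_fin (nrm_ge0 hR).
  by apply: ereal_sup_ubound; exists n, n.
apply: ereal_sup_ubound; exists (fun=> 0) => // f hf N.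
by rewrite (lin0 (Y := K^o) hf.1) big1 // => i _; rewrite normr0.
Qed.

Theorem uc_fix_c0 (X Y : completeNormedModType K) (T : X -> Y) :
  (forall (V : normedModType K) (x : V), exists f, dual_ball f /\ `|f x| = `|x|) ->
  (forall u : nat -> K, ecauchy toR u -> exists l, econv toR u l) ->
  is_linear T -> is_bounded T ->
  ((2^-1)%:E * uc toR T <= fix_c0 toR T /\ fix_c0 toR T <= uc toR T)%E.
Proof.
move=> norming complete_K linT /is_bounded_nrm[M M0 hM]; split; last first.
  rewrite /fix_c0; case: ifPn => [_|_]; first exact: uc_ge0.
  by apply: ge_ereal_sup => r; exact: fix_c0_vals_le_uc hR _ _ _ _ linT.
(* The factor 1/2 enters only here, through [0 <= uc]. *)
apply: (@le_trans _ _ (uc toR T)).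
  rewrite -[leRHS]mul1e; apply: lee_wpmul2r; first exact: uc_ge0.
  by rewrite lee_fin invf_le1 ?ler1n.
apply: ge_ereal_sup => _ [x hx <-].
exact: ca_le_fix_c0 hR norming complete_K _ _ _ _ linT M0 hM _ hx.
Qed.

End main.

Unset Implicit Arguments.

(* Real scalars (K = R, toR = id) and complex scalars (K = R[i], toR = Re). *)
Theorem theorem3p6 (R : realType) :
  (forall (X Y : completeNormedModType R) (T : X -> Y),
     is_linear T -> is_bounded T ->
     ((2^-1)%:E * uc (fun r : R => r) T <= fix_c0 (fun r : R => r) T /\
      fix_c0 (fun r : R => r) T <= uc (fun r : R => r) T)%E) /\
  (forall (X Y : completeNormedModType R[i]) (T : X -> Y),
     is_linear T -> is_bounded T ->
     ((2^-1)%:E * uc (@complex.Re R) T <= fix_c0 (@complex.Re R) T /\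
      fix_c0 (@complex.Re R) T <= uc (@complex.Re R) T)%E).
Proof.
split=> X Y T.
- apply: (uc_fix_c0 (real_part_id R)); first exact: norming_real.
  exact: complete_real.
- apply: (uc_fix_c0 (real_part_Re R)); first exact: norming_complex.
  exact: complete_complex.
Qed.
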